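(* Let $A,B\in\mathbb{M}_n$ be normal. Then, for some unitary $V\in\mathbb{M}_n$, $$ |A+B|\le |A|+|B|+\frac14 V(|A|+|B|)V^*. $$ If $n\ge 3$, the constant $1/4$ is the smallest possible one; that is, for every $n\ge 3$ and every real $c<1/4$ there exist normal matrices $A,B\in\mathbb{M}_n$ such that no unitary $V\in\mathbb{M}_n$ satisfies $|A+B|\le |A|+|B|+c\,V(|A|+|B|)V^*$.
   Context: $\mathbb{M}_n$ is the space of complex $n\times n$ matrices. For $Z\in\mathbb{M}_n$, $|Z|=(Z^*Z)^{1/2}$. The relation $\le$ between Hermitian matrices is the Loewner order ($S\le T$ iff $T-S$ is positive semidefinite). *)

(* Defs.v *)
From mathcomp Require Import all_boot all_order all_algebra.
From mathcomp Require Export spectral sesquilinear.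
From mathcomp Require Export complex.
From mathcomp Require Export reals.

Set Implicit Arguments.
Unset Strict Implicit.
Unset Printing Implicit Defensive.

Import Order.TTheory GRing.Theory Num.Theory.
Local Open Scope ring_scope.
Local Open Scope sesquilinear_scope.

Section MatrixAbs.
Variables (C : numClosedFieldType) (n : nat).
Implicit Types (M S T Z : 'M[C]_n).

(* In a numClosedFieldType, 0 <= z entails that z is real. *)
Definition psdmx M : Prop :=
  M \is hermsymmx /\ forall x : 'cV[C]_n, 0 <= (x^t* *m M *m x) 0 0.

Definition loewner_le S T : Prop := psdmx (T - S).

(* Functional calculus: for normal M, M = P^-1 diag(d) P with P unitary, and
   sqrtC takes the nonnegative root of each eigenvalue d_i >= 0. The value
   is meaningful for psdmx M only, where it is the positive semidefinite square
   root of M (sqrtmx_psd, sqrtmx_sqr). *)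
Definition sqrtmx M : 'M[C]_n :=
  invmx (spectralmx M) *m diag_mx (map_mx sqrtC (spectral_diag M))
    *m spectralmx M.

Definition absmx Z : 'M[C]_n := sqrtmx (Z^t* *m Z).

Lemma psdmx_gram Z : psdmx (Z^t* *m Z).
Proof.
split=> [|x].
  apply/is_hermitianmxP; rewrite expr0 scale1r.
  by rewrite trmx_mul map_mxM trmxCK.
have -> : x^t* *m (Z^t* *m Z) *m x = (Z *m x)^t* *m (Z *m x).
  by rewrite trmx_mul map_mxM !mulmxA.
rewrite mxE; apply: sumr_ge0 => i _.
by rewrite !mxE mulrC; exact: mul_conjC_ge0.
Qed.

Lemma spectral_diag_ge0 M i : psdmx M -> 0 <= spectral_diag M 0 i.
Proof.
move=> [/hermitian_normalmx/orthomx_spectralP Meq Mge0].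
have Pu := spectral_unitarymx M.
set P := spectralmx M in Meq Pu *; set d := spectral_diag M in Meq *.
have := Mge0 (P^t* *m delta_mx i 0); rewrite Meq (invmx_unitary Pu).
rewrite trmx_mul map_mxM trmxCK !mulmxA !mulmxtVK //.
rewrite -mulmxA mul_diag_mx mxE (bigD1 i) //= big1 ?addr0 => [|j /negPf ji].
  by rewrite !mxE !eqxx /= conjC1 mul1r mulr1.
by rewrite !mxE ji !andbT /= conjC0 mul0r.
Qed.

Lemma sqrtmx_sqr M : psdmx M -> sqrtmx M *m sqrtmx M = M.
Proof.
move=> psdM; rewrite /sqrtmx.
have [/hermitian_normalmx/orthomx_spectralP Meq _] := psdM.
set P := spectralmx M in Meq *; set d := spectral_diag M in Meq *.
have Pu : P \in unitmx := unitarymx_unit (spectral_unitarymx M).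
rewrite !mulmxA mulmxK // -(mulmxA (invmx P)) mulmx_diag [RHS]Meq.
congr (_ *m diag_mx _ *m _).
by apply/rowP => i; rewrite !mxE -expr2 sqrtCK.
Qed.

Lemma sqrtmx_psd M : psdmx M -> psdmx (sqrtmx M).
Proof.
move=> psdM; rewrite /sqrtmx (invmx_unitary (spectral_unitarymx M)).
set P := spectralmx M; set e := map_mx sqrtC _.
have e_ge0 i : 0 <= e 0 i by rewrite mxE sqrtC_ge0 spectral_diag_ge0.
pose f := map_mx sqrtC e.
have f_ge0 i : 0 <= f 0 i by rewrite mxE sqrtC_ge0 e_ge0.
have fC : (diag_mx f)^t* = diag_mx f.
  apply/matrixP => i j; move: (f) f_ge0 => g g_ge0; rewrite !mxE eq_sym.
  by case: eqVneq => [->|_]; rewrite ?mulr1n ?geC0_conj ?mulr0n ?conjC0.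
have -> : P^t* *m diag_mx e *m P = (diag_mx f *m P)^t* *m (diag_mx f *m P).
  rewrite trmx_mul map_mxM fC !mulmxA -(mulmxA (P^t*) (diag_mx f)) mulmx_diag.
  congr (_ *m diag_mx _ *m _).
  by apply/rowP => i; rewrite !mxE -!expr2 !sqrtCK.
exact: psdmx_gram.
Qed.

End MatrixAbs.

(* Main.v *)
Require Import Defs.
From mathcomp Require Import all_boot all_order all_algebra.
From mathcomp Require Import ring.
Set Implicit Arguments.
Unset Strict Implicit.
Unset Printing Implicit Defensive.

Import Order.TTheory GRing.Theory Num.Theory.
Local Open Scope ring_scope.
Local Open Scope sesquilinear_scope.

(** Why the inequality holds.  A normal matrix [A] has a symmetric polar form
    [A = G^* E G] with [E] unitary and [|A| = G^* G]
    ([normal_polar_factor]).  Expanding the Gram matrix of [G W - E G] gives,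
    for every [W], the Young-type inequality
      [W^* A + A^* W <= W^* |A| W + |A|]   ([absmx_young]).
    Let [A + B = U |A + B|] be a polar decomposition with [U] unitary
    ([polar_decomposition]), and take [W = U / 2] for both [A] and [B].  The
    sum of the two left-hand sides is
    [(U^* (A + B) + (A + B)^* U) / 2 = |A + B|], and the sum of the two
    right-hand sides is [|A| + |B| + U^* (|A| + |B|) U / 4]: the unitary is
    [V = U^*].

    Why 1/4 is optimal.  The inequality is an equality along a vector [h] when
    [G U h = 2 E G h] for both matrices, and then 1/4 cannot be lowered, even
    with another unitary, if [U h] is a top eigenvector of [|A| + |B|].  Rank
    one matrices on a plane achieve both: up to padding with zeros,
      [A = (2,1)^T (2,1)]  and  [B = - (2,-1)^T (2,-1)]
    give [|A| + |B| = diag(8, 2)] while [A + B] is 4 times the swap of the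
    two coordinates, so that [|A + B| = diag(4, 4)].  The second diagonal
    entry of the inequality with constant [c] then reads [4 <= 2 + c q], where
    [q] is a diagonal entry of [V diag(8, 2, 0, ..., 0) V^*] and thus lies
    between 0 and 8 ([extremal_pair]).  Hence [c >= 1/4]. *)

(** * Conjugate transposes and unitary conjugation *)

Lemma trmxC_mul (C : numClosedFieldType) m n p
    (A : 'M[C]_(m, n)) (B : 'M[C]_(n, p)) :
  (A *m B)^t* = B^t* *m A^t*.
Proof. by rewrite trmx_mul map_mxM. Qed.

Lemma trmxC_add (C : numClosedFieldType) m n (A B : 'M[C]_(m, n)) :
  (A + B)^t* = A^t* + B^t*.
Proof. by rewrite linearD map_mxD. Qed.

Lemma trmxC_opp (C : numClosedFieldType) m n (A : 'M[C]_(m, n)) :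
  (- A)^t* = - A^t*.
Proof. by rewrite linearN map_mxN. Qed.

Lemma trmxC_scale (C : numClosedFieldType) m n (a : C) (A : 'M[C]_(m, n)) :
  (a *: A)^t* = a^* *: A^t*.
Proof. by rewrite linearZ map_mxZ. Qed.

Lemma trmxC_diag (C : numClosedFieldType) n (d : 'rV[C]_n) :
  (diag_mx d)^t* = diag_mx (map_mx Num.conj d).
Proof. by rewrite tr_diag_mx map_diag_mx. Qed.

Lemma trmxC_delta (C : numClosedFieldType) m n i j :
  (delta_mx i j : 'M[C]_(m, n))^t* = delta_mx j i.
Proof. by rewrite trmx_delta map_delta_mx. Qed.

Lemma unitary_trmxC_mul (C : numClosedFieldType) n (P : 'M[C]_n) :
  P \is unitarymx -> P^t* *m P = 1%:M.
Proof. by move=> Pu; apply: mulmx1C; exact/unitarymxP. Qed.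

Lemma unitary_conj_mul (C : numClosedFieldType) n (P M N : 'M[C]_n) :
  P \is unitarymx ->
  (P^t* *m M *m P) *m (P^t* *m N *m P) = P^t* *m (M *m N) *m P.
Proof. by move=> Pu; rewrite !mulmxA mulmxtVK. Qed.

(** * Uniqueness of the positive square root *)

Lemma psdmx_trmxC (C : numClosedFieldType) n (M : 'M[C]_n) :
  psdmx M -> M^t* = M.
Proof. by case=> /is_hermitianmxP; rewrite expr0 scale1r => <-. Qed.

Lemma psdmx_spectral (C : numClosedFieldType) n (M : 'M[C]_n) : psdmx M ->
  exists (P : 'M[C]_n) (d : 'rV[C]_n),
    [/\ P \is unitarymx, forall i, 0 <= d 0 i & M = P^t* *m diag_mx d *m P].
Proof.
move=> Mpsd; exists (spectralmx M), (spectral_diag M); split.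
- exact: spectral_unitarymx.
- by move=> i; exact: spectral_diag_ge0.
have [/hermitian_normalmx/orthomx_spectralP ME _] := Mpsd.
by rewrite [LHS]ME (invmx_unitary (spectral_unitarymx M)).
Qed.

(** Diagonalize [S = P^* d P] and [T = Q^* e Q].  The change of basis
    [W = Q P^*] intertwines [d^2] and [e^2], hence also [d] and [e]: where the
    entry [W i j] is nonzero, [d j ^ 2 = e i ^ 2], and both are nonnegative. *)
Lemma psdmx_sqr_inj (C : numClosedFieldType) n (S T : 'M[C]_n) :
  psdmx S -> psdmx T -> S *m S = T *m T -> S = T.
Proof.
move=> /psdmx_spectral[P [d [Pu d_ge0 ->]]].
move=> /psdmx_spectral[Q [e [Qu e_ge0 ->]]].
rewrite !unitary_conj_mul // => /(congr1 (fun M => Q *m M *m P^t*)).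
have QQ := unitary_trmxC_mul Qu; have PP := unitary_trmxC_mul Pu.
rewrite !mulmxA (unitarymxP Qu) mul1mx !mulmxtVK // -!mulmxA.
rewrite mulmx_diag !mulmxA mulmx_diag -[RHS]mulmxA.
set W := Q *m P^t* => eqW.
suff comW : W *m diag_mx d = diag_mx e *m W.
  have /(congr1 (fun M => Q^t* *m M *m P)) := comW.
  by rewrite /W !mulmxA QQ mul1mx => ->; rewrite -!mulmxA PP mulmx1.
move: W eqW => W /matrixP eqW; apply/matrixP => i j; move: (eqW i j).
rewrite !mul_mx_diag !mul_diag_mx !mxE.
have [->|w0] := eqVneq (W i j) 0; first by rewrite !(mul0r, mulr0).
rewrite [RHS]mulrC => /(mulfI w0)/eqP; rewrite -!expr2 eqrXn2 // => /eqP ->.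
exact: mulrC.
Qed.

Lemma absmx_unique (C : numClosedFieldType) n (S Z : 'M[C]_n) :
  psdmx S -> S *m S = Z^t* *m Z -> absmx Z = S.
Proof.
move=> Spsd eqS; apply: psdmx_sqr_inj => //.
  exact/sqrtmx_psd/psdmx_gram.
by rewrite sqrtmx_sqr //; exact: psdmx_gram.
Qed.

Lemma absmx_psd_id (C : numClosedFieldType) n (S : 'M[C]_n) :
  psdmx S -> absmx S = S.
Proof. by move=> Spsd; apply: absmx_unique; rewrite ?psdmx_trmxC. Qed.

Lemma absmxN (C : numClosedFieldType) n (Z : 'M[C]_n) : absmx (- Z) = absmx Z.
Proof. by rewrite /absmx trmxC_opp mulNmx mulmxN opprK. Qed.

(** * Polar decompositions *)

Lemma row_gram_unit (C : numClosedFieldType) n (v : 'rV[C]_n) : v != 0 ->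
  exists a : C, (a *: v) *m (a *: v)^t* = 1%:M.
Proof.
move=> v0; set q := (v *m v^t*) 0 0.
have qE : q = \sum_j `|v 0 j| ^+ 2.
  by rewrite /q mxE; apply: eq_bigr => j _; rewrite !mxE normCK.
have q_gt0 : 0 < q.
  rewrite lt0r {2}qE sumr_ge0 ?andbT => [|j _]; last exact: exprn_ge0.
  apply: contraNneq v0; rewrite qE => /eqP.
  rewrite psumr_eq0 => [/allP sq0|j _]; last exact: exprn_ge0.
  apply/eqP/rowP => j; have := sq0 j (mem_index_enum j).
  by rewrite sqrf_eq0 normr_eq0 mxE => /eqP.
exists (sqrtC q)^-1.
rewrite trmxC_scale geC0_conj ?invr_ge0 ?sqrtC_ge0 ?ltW //.
rewrite -scalemxAl -scalemxAr scalerA.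
rewrite [v *m _]mx11_scalar -/q -scalemx1 scalerA -invfM -expr2 sqrtCK.
by rewrite mulVf ?scale1r // gt_eqF.
Qed.

(** This is the polar decomposition of a matrix with orthogonal rows of norms
    [s i].  If all norms are nonzero, rescaling the rows suffices.  Otherwise
    some row vanishes, so some unit vector is orthogonal to all the rows;
    placing it in the vanishing row lowers the number of zero norms without
    changing the claim, since that row is multiplied by 0 in the end. *)
Lemma diag_gram_factor (C : numClosedFieldType) n (s : 'rV[C]_n) (Z : 'M[C]_n) :
  (forall i, 0 <= s 0 i) -> Z *m Z^t* = diag_mx s *m diag_mx s ->
  exists2 W, W \is unitarymx & Z = diag_mx s *m W.
Proof.
have [k] := ubnP #|[set i | s 0 i == 0]|.
elim: k => // k IHk in s Z *; rewrite ltnS => le_k s_ge0 ZZ.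
case: (pickP [pred i | s 0 i == 0]) => [i /eqP si0 | s_neq0]; last first.
  pose t := \row_j (s 0 j)^-1.
  have st : diag_mx s *m diag_mx t = 1%:M.
    rewrite mulmx_diag -diag_const_mx; congr diag_mx.
    by apply/rowP => j; rewrite !mxE mulfV // (negbT (s_neq0 j)).
  have ts : diag_mx t *m diag_mx s = 1%:M by exact: mulmx1C.
  exists (diag_mx t *m Z); last by rewrite mulmxA st mul1mx.
  apply/unitarymxP; rewrite trmxC_mul trmxC_diag.
  have -> : map_mx Num.conj t = t.
    by apply/rowP => j; rewrite !mxE geC0_conj // invr_ge0.
  by rewrite mulmxA -(mulmxA _ Z) ZZ !mulmxA ts mul1mx st.
have Zi0 j : Z i j = 0.
  have /eqP : (Z *m Z^t*) i i = 0.
    by rewrite ZZ mulmx_diag !mxE eqxx si0 mulr0.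
  rewrite mxE psumr_eq0 => [/allP sq0|l _]; last first.
    by rewrite !mxE mul_conjC_ge0.
  by have := sq0 j (mem_index_enum j); rewrite !mxE mul_conjC_eq0 => /eqP.
have [v v_ne0 vZ] : exists2 v : 'rV[C]_n, v != 0 & v *m Z^t* = 0.
  have /rowV0Pn[v] : kermx (Z^t*) != 0.
    rewrite kermx_eq0 row_free_unit; apply/negP => Zu.
    have Zd0 : Z^t* *m (delta_mx i 0 : 'cV_n) = 0.
      by rewrite -colE; apply/colP => j; rewrite !mxE Zi0 conjC0.
    have /matrixP/(_ i 0) : (delta_mx i 0 : 'cV[C]_n) = 0.
      by rewrite -[LHS](mulKmx Zu) Zd0 mulmx0.
    by rewrite !mxE !eqxx => /eqP; rewrite oner_eq0.
  by move=> /sub_kermxP vZ v0; exists v.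
have [a uu] := row_gram_unit v_ne0; set u := a *: v in uu.
have uZ : u *m Z^t* = 0 by rewrite -scalemxAl vZ scaler0.
have Zu : Z *m u^t* = 0.
  by rewrite -[LHS]trmxCK trmxC_mul trmxCK uZ trmx0 map_mx0.
pose s' : 'rV_n := s + delta_mx 0 i.
pose Z' : 'M_n := Z + (delta_mx i 0 : 'cV_n) *m u.
have s'E j : s' 0 j = if j == i then 1 else s 0 j.
  rewrite !mxE eqxx /=; case: eqVneq => [->|_]; last by rewrite addr0.
  by rewrite si0 add0r.
have [W Wu Z'E] : exists2 W, W \is unitarymx & Z' = diag_mx s' *m W.
  apply: IHk => [|j|].
  - apply: leq_trans le_k; apply: proper_card; apply/properP; split.
      apply/subsetP => j; rewrite !inE s'E.
      by case: ifP => //; rewrite oner_eq0.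
    by exists i; rewrite !inE ?s'E ?si0 ?eqxx // oner_eq0.
  - by rewrite s'E; case: ifP => // _; exact: ler01.
  rewrite trmxC_add trmxC_mul trmxC_delta mulmxDl !mulmxDr ZZ.
  rewrite (mulmxA Z) Zu mul0mx addr0.
  rewrite -(mulmxA _ u (Z^t*)) uZ mulmx0 add0r mulmxA -(mulmxA _ u) uu mulmx1.
  rewrite mul_delta_mx !mulmx_diag; apply/matrixP => j l; rewrite !mxE.
  rewrite !eqxx /=; case: (eqVneq j l) => [<-|jl]; rewrite ?andbb.
    case: eqVneq => [->|_]; rewrite ?addr0 //.
    by rewrite si0 add0r !mulr1n mulr1 mul0r add0r.
  rewrite !mulr0n add0r; case: eqVneq => //= <-.
  by rewrite eq_sym (negPf jl).
exists W => //; apply/matrixP => j l.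
have : Z' j l = s' 0 j * W j l by rewrite Z'E mul_diag_mx mxE.
have -> : (diag_mx s *m W) j l = s 0 j * W j l by rewrite mul_diag_mx mxE.
rewrite s'E; case: eqVneq => [-> _|ji <-]; first by rewrite Zi0 si0 mul0r.
by rewrite !mxE big1 ?addr0 // => k' _; rewrite !mxE (negPf ji) mul0r.
Qed.

(** If [P] diagonalizes [|X|] as [P^* s P], then the rows of [P X^*] are
    orthogonal with norms [s], and [diag_gram_factor] provides the unitary,
    also for singular [X]. *)
Lemma polar_decomposition (C : numClosedFieldType) n (X : 'M[C]_n) :
  exists2 U, U \is unitarymx & X = U *m absmx X.
Proof.
have [P [s [Pu s_ge0 absE]]] := psdmx_spectral (sqrtmx_psd (psdmx_gram X)).
have sqE : absmx X *m absmx X = X^t* *m X by exact/sqrtmx_sqr/psdmx_gram.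
have PP := unitary_trmxC_mul Pu.
have [W Wu ZE] : exists2 W, W \is unitarymx & P *m X^t* = diag_mx s *m W.
  apply: diag_gram_factor => //.
  rewrite trmxC_mul trmxCK mulmxA -(mulmxA P) -sqE /absmx absE.
  by rewrite unitary_conj_mul // !mulmxA (unitarymxP Pu) mul1mx mulmxtVK.
exists ((P^t* *m W)^t*).
  by rewrite trmxC_unitary mul_unitarymx // trmxC_unitary.
have absC : (absmx X)^t* = absmx X by exact/psdmx_trmxC/sqrtmx_psd/psdmx_gram.
rewrite -[LHS]trmxCK -[X^t*]mul1mx -PP -mulmxA ZE -[absmx X]absC -trmxC_mul.
by rewrite /absmx absE !mulmxA mulmxtVK.
Qed.

(** Normality makes [A] and [|A|] simultaneously diagonal, so that the polar
    factor can be written between two copies of [|A|^(1/2)].  In an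
    eigenbasis [P] of [A] with eigenvalues [d], take
    [G = diag(|d|^(1/2)) P] and let [E] hold the phases of [d]. *)
Lemma normal_polar_factor (C : numClosedFieldType) n (A : 'M[C]_n) :
  A \is normalmx -> exists G E : 'M[C]_n,
    [/\ E \is unitarymx, A = G^t* *m E *m G & absmx A = G^t* *m G].
Proof.
move=> /orthomx_spectralP; have Pu := spectral_unitarymx A.
rewrite (invmx_unitary Pu).
set P := spectralmx A in Pu *; set d := spectral_diag A => AE.
pose f := \row_i sqrtC `|d 0 i|.
(* The phase of a zero eigenvalue is set to 1 to keep [E] unitary. *)
pose e := \row_i (if d 0 i == 0 then 1 else d 0 i / `|d 0 i|).
have fC : map_mx Num.conj f = f.
  by apply/rowP => i; rewrite !mxE geC0_conj // sqrtC_ge0.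
have ee i : e 0 i * (e 0 i)^* = 1.
  rewrite -normCK mxE; have [_|d0] := eqVneq (d 0 i) 0.
    by rewrite normr1 expr1n.
  by rewrite normf_div normr_id divff ?expr1n // normr_eq0.
have fef i : f 0 i * e 0 i * f 0 i = d 0 i.
  rewrite mulrAC -expr2 !mxE sqrtCK; case: eqP => [->|/eqP d0].
    by rewrite normr0 mul0r.
  by rewrite mulrC mulfVK // normr_eq0.
have conj_diag (a b : 'rV[C]_n) : (diag_mx a *m P)^t* *m (diag_mx b *m P)
    = P^t* *m (diag_mx (map_mx Num.conj a) *m diag_mx b) *m P.
  by rewrite trmxC_mul trmxC_diag !mulmxA.
exists (diag_mx f *m P), (diag_mx e); split.
- apply/unitarymxP; rewrite trmxC_diag mulmx_diag -diag_const_mx.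
  congr diag_mx; apply/rowP => i; rewrite [in LHS]mxE [in RHS]mxE -(ee i).
  by congr (_ * _); rewrite mxE.
- rewrite AE -(mulmxA _ (diag_mx e)) (mulmxA (diag_mx e)) mulmx_diag.
  rewrite conj_diag fC mulmx_diag; congr (_ *m diag_mx _ *m _).
  apply/rowP => i; rewrite -fef -mulrA [RHS]mxE.
  by congr (_ * _); rewrite [RHS]mxE.
apply: absmx_unique; first exact: psdmx_gram.
rewrite conj_diag fC AE unitary_conj_mul //.
rewrite !trmxC_mul trmxCK trmxC_diag.
rewrite [in RHS](mulmxA (P^t*)) unitary_conj_mul //.
rewrite !mulmx_diag; congr (_ *m diag_mx _ *m _); apply/rowP => i.
by rewrite !mxE -!expr2 !sqrtCK normCK mulrC.
Qed.

(** * The inequality with constant 1/4 *)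

(** With [A = G^* E G] and [|A| = G^* G], the difference of the two sides is
    the Gram matrix of [G W - E G]. *)
Lemma absmx_young (C : numClosedFieldType) n (A W : 'M[C]_n) :
  A \is normalmx ->
  psdmx (W^t* *m absmx A *m W + absmx A - (W^t* *m A + A^t* *m W)).
Proof.
move=> /normal_polar_factor[G [E [Eu AE absE]]].
suff -> : W^t* *m absmx A *m W + absmx A - (W^t* *m A + A^t* *m W)
    = (G *m W - E *m G)^t* *m (G *m W - E *m G) by exact: psdmx_gram.
rewrite absE AE trmxC_add trmxC_opp !trmxC_mul trmxCK.
rewrite mulmxBl !mulmxBr !mulmxA -(mulmxA _ (E^t*) E) (unitary_trmxC_mul Eu).
rewrite mulmx1 !opprD !opprK.
by rewrite addrACA; congr (_ + _); exact: addrC.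
Qed.

Lemma psdmxD (C : numClosedFieldType) n (S T : 'M[C]_n) :
  psdmx S -> psdmx T -> psdmx (S + T).
Proof.
move=> Sp Tp; split=> [|x].
  by apply/is_hermitianmxP; rewrite expr0 scale1r trmxC_add !psdmx_trmxC.
have [_ /(_ x) S0] := Sp; have [_ /(_ x) T0] := Tp.
by rewrite mulmxDr mulmxDl mxE addr_ge0.
Qed.

Lemma absmx_add_le_quarter (C : numClosedFieldType) n (A B : 'M[C]_n) :
  A \is normalmx -> B \is normalmx -> exists2 V, V \is unitarymx &
  loewner_le (absmx (A + B))
    (absmx A + absmx B + 4^-1 *: (V *m (absmx A + absmx B) *m V^t*)).
Proof.
move=> An Bn; have [U Uu UX] := polar_decomposition (A + B).
exists (U^t*); first by rewrite trmxC_unitary.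
have absC : (absmx (A + B))^t* = absmx (A + B).
  exact/psdmx_trmxC/sqrtmx_psd/psdmx_gram.
have half2 : (2^-1 : C) + 2^-1 = 1 by rewrite [RHS]splitr !div1r.
have halfC : ((2^-1 : C))^* = 2^-1 by rewrite geC0_conj // invr_ge0 ler0n.
have UA : U^t* *m (A + B) = absmx (A + B).
  by rewrite {1}UX mulmxA unitary_trmxC_mul // mul1mx.
have AU : (A + B)^t* *m U = absmx (A + B).
  by rewrite -[U]trmxCK -trmxC_mul UA.
rewrite /loewner_le trmxCK.
have := psdmxD (absmx_young (2^-1 *: U) An) (absmx_young (2^-1 *: U) Bn).
congr psdmx; rewrite trmxC_scale halfC addrACA -opprD.
have -> : absmx (A + B) = 2^-1 *: (U^t* *m (A + B) + (A + B)^t* *m U).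
  by rewrite UA AU scalerDr -scalerDl half2 scale1r.
rewrite -!scalemxAl -!scalemxAr !scalerA -invfM -natrM.
rewrite !trmxC_add mulmxDr mulmxDl [in RHS]mulmxDr [in RHS]mulmxDl.
rewrite !scalerDr; congr (_ - _); last exact: addrACA.
by rewrite addrACA addrC.
Qed.

(** * Optimality of the constant *)

(** The entry is an average of the [d j] with weights [|V i j|^2], which sum
    to 1. *)
Lemma unitary_diag_entry_bound (C : numClosedFieldType) n (V : 'M[C]_n)
    (d : 'rV[C]_n) (m : C) i :
  V \is unitarymx -> (forall j, 0 <= d 0 j <= m) ->
  0 <= (V *m diag_mx d *m V^t*) i i <= m.
Proof.
move=> Vu d_bnd.
have entryE : (V *m diag_mx d *m V^t*) i i = \sum_j d 0 j * `|V i j| ^+ 2.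
  rewrite mul_mx_diag mxE; apply: eq_bigr => j _.
  by rewrite !mxE normCK mulrA [d 0 j * _]mulrC.
have mE : m = \sum_j m * `|V i j| ^+ 2.
  have /matrixP/(_ i i) := unitarymxP Vu.
  rewrite !mxE eqxx => VV; rewrite -mulr_sumr -[LHS]mulr1 -[1 in LHS]VV.
  by congr (_ * _); apply: eq_bigr => j _; rewrite !mxE normCK.
rewrite entryE sumr_ge0 => [/=|j _]; last first.
  by have /andP[dj _] := d_bnd j; rewrite mulr_ge0 ?exprn_ge0.
rewrite [leRHS]mE; apply: ler_sum => j _.
by have /andP[_ dj] := d_bnd j; rewrite ler_wpM2r ?exprn_ge0.
Qed.

Section Extremal.
Variables (C : numClosedFieldType) (n : nat) (i0 i1 : 'I_n).
Hypothesis i01 : i0 != i1.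

Let E i j : 'M[C]_n := delta_mx i j.
(* The vector with entries 2 at [i0] and [a] at [i1], stored as a column of a
   square matrix. *)
Let G a : 'M[C]_n := 2 *: E i0 i0 + a *: E i1 i0.
Let gram a : 'M[C]_n := G a *m (G a)^t*.

Lemma gram_psd a : psdmx (gram a).
Proof. by rewrite /gram -{1}[G a]trmxCK; exact: psdmx_gram. Qed.

Lemma gramE a : a^* = a -> gram a
  = 4 *: E i0 i0 + (2 * a) *: (E i0 i1 + E i1 i0) + a ^+ 2 *: E i1 i1.
Proof.
move=> aC; rewrite /gram /G /E trmxC_add !trmxC_scale !trmxC_delta aC.
rewrite geC0_conj ?ler0n // mulmxDl !mulmxDr -!scalemxAl -!scalemxAr.
rewrite !mul_delta_mx !scalerA -natrM -expr2 [a * 2]mulrC scalerDr.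
by rewrite !addrA.
Qed.

Lemma gram_sum : gram 1 + gram (-1) = 8 *: E i0 i0 + 2 *: E i1 i1.
Proof.
rewrite !gramE ?conjC1 // ?rmorphN1 //.
by apply/matrixP => i j; rewrite !mxE; ring.
Qed.

Lemma gram_diff : gram 1 - gram (-1) = 4 *: (E i0 i1 + E i1 i0).
Proof.
rewrite !gramE ?conjC1 // ?rmorphN1 //.
by apply/matrixP => i j; rewrite !mxE; ring.
Qed.

(** The difference is 4 times the swap of the coordinates [i0] and [i1], whose
    square is the projection on these coordinates. *)
Lemma absmx_gram_diff :
  absmx (gram 1 - gram (-1)) = 4 *: (E i0 i0 + E i1 i1).
Proof.
rewrite gram_diff.
have i10 : (i1 == i0) = false by rewrite eq_sym (negPf i01).
have fourC : (4 : C)^* = 4 by rewrite geC0_conj ?ler0n.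
have twoC : (2 : C)^* = 2 by rewrite geC0_conj ?ler0n.
have EE i j k l : E i j *m E k l = (if j == k then E i l else 0).
  by rewrite /E mul_delta_mx_cond; case: eqP => _; rewrite ?mulr1n ?mulr0n.
have sqE : (E i0 i0 + E i1 i1) *m (E i0 i0 + E i1 i1) = E i0 i0 + E i1 i1.
  by rewrite mulmxDl !mulmxDr !EE !eqxx (negPf i01) i10 addr0 add0r.
have symE : (E i0 i0 + E i1 i1)^t* = E i0 i0 + E i1 i1.
  by rewrite trmxC_add !trmxC_delta.
apply: absmx_unique.
  have -> : 4 *: (E i0 i0 + E i1 i1)
      = (2 *: (E i0 i0 + E i1 i1))^t* *m (2 *: (E i0 i0 + E i1 i1)).
    rewrite trmxC_scale symE twoC -scalemxAl -scalemxAr sqE scalerA.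
    by rewrite -natrM.
  exact: psdmx_gram.
rewrite trmxC_scale trmxC_add !trmxC_delta fourC.
rewrite -!scalemxAl -!scalemxAr sqE; congr (_ *: (_ *: _)).
rewrite mulmxDl !mulmxDr !EE !eqxx (negPf i01) i10 addr0 add0r.
by rewrite addrC.
Qed.

(** The conclusion is the diagonal entry at [i1] of the inequality; any [c]
    with such a [q] is at least 1/4. *)
Lemma extremal_pair : exists A B : 'M[C]_n,
  [/\ A \is normalmx, B \is normalmx &
   forall (V : 'M[C]_n) (c : C), V \is unitarymx ->
     loewner_le (absmx (A + B))
       (absmx A + absmx B + c *: (V *m (absmx A + absmx B) *m V^t*)) ->
     exists2 q : C, 0 <= q <= 8 & 2 <= c * q].
Proof.
exists (gram 1), (- gram (-1)).
have norm_gram a : gram a \is normalmx.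
  by apply/normalmxP; rewrite (psdmx_trmxC (gram_psd a)).
split=> // [|V c Vu].
  by apply/normalmxP; rewrite trmxC_opp (psdmx_trmxC (gram_psd _)).
rewrite absmxN !(absmx_psd_id (gram_psd _)) absmx_gram_diff gram_sum.
move=> [_ /(_ (delta_mx i1 0))].
pose d := \row_j (8 * (j == i0)%:R + 2 * (j == i1)%:R) : 'rV[C]_n.
have -> : 8 *: E i0 i0 + 2 *: E i1 i1 = diag_mx d.
  apply/matrixP => i j; rewrite !mxE; have [->|ij] := eqVneq i j.
    by rewrite !andbb mulr1n.
  have offdiag k : (i == k) && (j == k) = false.
    by apply: contraNF ij => /andP[/eqP-> /eqP->].
  by rewrite !offdiag !mulr0 addr0.
have d_bnd j : 0 <= d 0 j <= 8.
  rewrite mxE; have [->|ji0] := eqVneq j i0.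
    by rewrite (negPf i01) mulr1 mulr0 addr0 lexx ler0n.
  by case: eqP => _; rewrite !(mulr0, mulr1, add0r) ?lexx !ler0n // ler_nat.
have := @unitary_diag_entry_bound C n V d 8 i1 Vu d_bnd.
move: (V *m _ *m _) => Q Qbnd le0; exists (Q i1 i1) => //.
move: le0; rewrite trmxC_delta -mulmxA -colE -rowE !mxE.
rewrite (eq_sym i1) (negPf i01) !eqxx mulr0 mulr1 add0r mulr1n add0r mulr1.
by rewrite subr_ge0 (natrD _ 2 2) lerD2l.
Qed.

End Extremal.

Local Open Scope complex_scope.

Theorem corollary4p2 (R : realType) (n : nat) :
  (forall A B : 'M[R[i]]_n, A \is normalmx -> B \is normalmx ->
     exists2 V : 'M[R[i]]_n, V \is unitarymx &
       loewner_le (absmx (A + B))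
         (absmx A + absmx B
          + (4^-1 : R)%:C *: (V *m (absmx A + absmx B) *m V^t*)))
  /\
  ((3 <= n)%N -> forall c : R, c < 4^-1 ->
     exists A B : 'M[R[i]]_n,
       [/\ A \is normalmx, B \is normalmx &
        ~ exists2 V : 'M[R[i]]_n, V \is unitarymx &
            loewner_le (absmx (A + B))
              (absmx A + absmx B
               + c%:C *: (V *m (absmx A + absmx B) *m V^t*))]).
Proof.
have quarterC : (4^-1 : R)%:C = 4^-1 by rewrite fmorphV rmorph_nat.
split=> [A B An Bn | n_ge3 c c_lt].
  by rewrite quarterC; exact: absmx_add_le_quarter.
pose i0 : 'I_n := Ordinal (leq_trans (isT : (0 < 3)%N) n_ge3).
pose i1 : 'I_n := Ordinal (leq_trans (isT : (1 < 3)%N) n_ge3).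
have [A [B [An Bn AB]]] := @extremal_pair R[i] n i0 i1 isT.
exists A, B; split=> // -[V Vu /(AB V _ Vu)[q /andP[q_ge0 q_le8]]].
move=> /le_lt_trans cq_ge2; suff /cq_ge2 : c%:C * q < 2 by rewrite ltxx.
have {}c_lt : c%:C < 4^-1 :> R[i] by rewrite -quarterC ltcR.
have [->|q0] := eqVneq q 0; first by rewrite mulr0; exact: ltr0n.
apply: (@lt_le_trans _ _ (4^-1 * q)); first by rewrite ltr_pM2r // lt0r q0.
by rewrite mulrC ler_pdivrMr ?ltr0n // -natrM.
Qed.
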